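(* Let $\mathbb{K}$ be an algebraically closed field of characteristic $0$, let $\mathfrak{l}$ be a semisimple Lie algebra over $\mathbb{K}$, and let $\mathfrak{g}=\mathfrak{l}\otimes\mathbb{K}[x]$ or $\mathfrak{g}=\mathfrak{l}\otimes\mathbb{K}[x,x^{-1}]$ be its current algebra or loop algebra. Then the center of the universal enveloping algebra $U(\mathfrak{g})$ is $Z(\mathfrak{g})=\mathbb{K}$.
   Context: The current algebra $\mathfrak{l}\otimes\mathbb{K}[x]$ and the loop algebra $\mathfrak{l}\otimes\mathbb{K}[x,x^{-1}]$ have Lie bracket $[e\otimes x^r,f\otimes x^s]=[e,f]\otimes x^{r+s}$ for $e,f\in\mathfrak{l}$ and $r,s\in\mathbb{N}$ (resp. $r,s\in\mathbb{Z}$). $Z(\mathfrak{g})=\{z\in U(\mathfrak{g})\mid zu=uz\ \forall u\in U(\mathfrak{g})\}$. *)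

(* Defs.v *)
From HB Require Import structures.
From mathcomp Require Import all_boot all_algebra.
From mathcomp Require Import generic_quotient finmap.
From mathcomp Require Import monalg.
From mathcomp Require Import boolp classical_sets.

Set Implicit Arguments.
Unset Strict Implicit.
Unset Printing Implicit Defensive.

Import GRing.Theory.

Local Open Scope fset_scope.
Local Open Scope ring_scope.

(* -------------------------------------------------------------------- *)
HB.mixin Record Lmodule_isLie (K : fieldType) L of GRing.Lmodule K L := {
  lie : L -> L -> L;
  lie_linearl : forall (a : K) x y z,
    lie (a *: x + y) z = a *: lie x z + lie y z;
  lie_linearr : forall (a : K) x y z,
    lie z (a *: x + y) = a *: lie z x + lie z y;
  liexx : forall x, lie x x = 0;
  lie_jacobi : forall x y z,
    lie x (lie y z) + lie y (lie z x) + lie z (lie x y) = 0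
}.

#[short(type="lieAlgType")]
HB.structure Definition LieAlgebra (K : fieldType) :=
  {L of GRing.Lmodule K L & Lmodule_isLie K L}.

#[short(type="finLieAlgType")]
HB.structure Definition FinDimLieAlgebra (K : fieldType) :=
  {L of LieAlgebra K L & Vector K L}.

Section LieTheory.
Context {K : fieldType} {L : lieAlgType K}.
Implicit Types (x y z : L) (a : K).

Lemma lieDl x y z : lie (x + y) z = lie x z + lie y z.
Proof. by have := lie_linearl 1 x y z; rewrite !scale1r. Qed.

Lemma lieDr x y z : lie z (x + y) = lie z x + lie z y.
Proof. by have := lie_linearr 1 x y z; rewrite !scale1r. Qed.

Lemma lie0x x : lie 0 x = 0.
Proof. by apply: (@addrI _ (lie 0 x)); rewrite -lieDl !addr0. Qed.

Lemma liex0 x : lie x 0 = 0.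
Proof. by apply: (@addrI _ (lie x 0)); rewrite -lieDr !addr0. Qed.

Lemma lieZl a x y : lie (a *: x) y = a *: lie x y.
Proof. by have := lie_linearl a x 0 y; rewrite lie0x !addr0. Qed.

Lemma lieZr a x y : lie y (a *: x) = a *: lie y x.
Proof. by have := lie_linearr a x 0 y; rewrite liex0 !addr0. Qed.

Lemma lieC x y : lie x y = - lie y x.
Proof.
apply/eqP; rewrite -addr_eq0; apply/eqP.
by have := liexx (x + y); rewrite lieDl !lieDr !liexx add0r addr0.
Qed.

Lemma lie_suml I (r : seq I) (P : pred I) (F : I -> L) z :
  lie (\sum_(i <- r | P i) F i) z = \sum_(i <- r | P i) lie (F i) z.
Proof.
by apply: (big_morph (fun x => lie x z)) => [x y|]; rewrite ?lieDl ?lie0x.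
Qed.

Lemma lie_sumr I (r : seq I) (P : pred I) (F : I -> L) z :
  lie z (\sum_(i <- r | P i) F i) = \sum_(i <- r | P i) lie z (F i).
Proof.
by apply: (big_morph (fun x => lie z x)) => [x y|]; rewrite ?lieDr ?liex0.
Qed.

End LieTheory.

(* -------------------------------------------------------------------- *)
Section Semisimple.
Context {K : fieldType} {L : finLieAlgType K}.
Implicit Types (U V W I : {vspace L}).

(* The span of all brackets lie u v with u in U and v in V; by bilinearity
   it is enough to take u and v in bases (see lievP). *)
Definition liev U V : {vspace L} :=
  <<[seq lie u v | u <- vbasis U, v <- vbasis V]>>%VS.

Definition lie_ideal I : Prop := forall x y : L, y \in I -> lie x y \in I.

Definition derived_series U (n : nat) : {vspace L} :=
  iter n (fun W => liev W W) U.

Definition lie_solvable U : Prop := exists n, derived_series U n = 0%VS.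

Lemma memv_lie U V u v : u \in U -> v \in V -> lie u v \in liev U V.
Proof.
move=> uU vV; rewrite (coord_vbasis uU) (coord_vbasis vV).
rewrite lie_suml memv_suml // => i _; rewrite lie_sumr memv_suml // => j _.
rewrite lieZl lieZr !memvZ // memv_span //; apply/allpairsP.
by exists ((vbasis U)`_i, (vbasis V)`_j); rewrite !mem_nth ?size_tuple.
Qed.

Lemma lievP (U V W : {vspace L}) :
  (forall u v, u \in U -> v \in V -> lie u v \in W) <-> (liev U V <= W)%VS.
Proof.
split=> [UVW|/subvP UVW u v uU vV]; last exact/UVW/memv_lie.
apply/span_subvP => _ /allpairsP[[u v] /= [uU vV ->]].
by apply: UVW; apply: vbasis_mem.
Qed.

End Semisimple.

Definition semisimple (K : fieldType) (L : finLieAlgType K) : Prop :=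
  forall I : {vspace L}, lie_ideal I -> lie_solvable I -> I = 0%VS.

(* -------------------------------------------------------------------- *)
(* The Lie algebra L (x) K[G], where K[G] is the algebra with K-basis the
   powers x^r, r in G, and x^r x^s = x^(r + s): K[x] for G = nat, K[x, x^-1]
   for G = int.  As K[G] is free on the x^r, L (x) K[G] is the direct sum of
   the L (x) x^r, i.e. the finitely supported functions G -> L; u@_r : L is
   the coefficient of x^r in u, and e (x) x^r is << e *g r >>.  See tensXP,
   lie_tensX and tensX_universal. *)
Definition tensor_powers (K : fieldType) (L : lieAlgType K) (G : nmodType) :=
  {malg L[G]}.

Section TensorPowers.
Context {K : fieldType} {L : lieAlgType K} {G : nmodType}.
Implicit Types (a : K) (e f : L) (r s : G).

Local Notation T := (tensor_powers L G).

HB.instance Definition _ := GRing.Zmodule.on T.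

Definition tensX e r : T := << e *g r >>.

Implicit Types (u v w : T).

Definition tensor_scale a u : T :=
  \sum_(r <- msupp u) tensX (a *: u@_r) r.

Definition tensor_lie u v : T :=
  \sum_(r <- msupp u) \sum_(s <- msupp v) tensX (lie u@_r v@_s) (r + s).

Lemma tensor_coeffP u v : (forall r, u@_r = v@_r) -> u = v.
Proof. by move=> uv; apply/malgP. Qed.

Lemma tensX_is_additive r : {morph tensX^~ r : e f / e + f}.
Proof. by move=> e f; rewrite /tensX -monalgUD. Qed.

Lemma tensX0 r : tensX 0 r = 0.
Proof. by apply: tensor_coeffP => s; rewrite mcoeffU mcoeff0 mul0rn. Qed.

Lemma tensor_coeffX e r s : (tensX e r)@_s = e *+ (r == s).
Proof. exact: mcoeffU. Qed.

Lemma tensor_coeff_sum I (q : seq I) (P : pred I) (F : I -> T) r :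
  (\sum_(i <- q | P i) F i)@_r = \sum_(i <- q | P i) (F i)@_r.
Proof. exact: (raddf_sum (mcoeff r)). Qed.

(* Every element is uniquely a finite sum of the e (x) x^r. *)
Lemma tensXP u : u = \sum_(r <- msupp u) tensX u@_r r.
Proof. exact: monalgE. Qed.

Lemma tensor_sumW (V : zmodType) (F : L -> G -> V) u (d : {fset G}) :
  (forall r, F 0 r = 0) -> msupp u `<=` d ->
  \sum_(r <- msupp u) F u@_r r = \sum_(r <- d) F u@_r r.
Proof.
by move=> F0 le; apply: big_fset_incl => //= r _ /mcoeff_outdom ->.
Qed.

Lemma tensor_coeffZ a u r : (tensor_scale a u)@_r = a *: u@_r.
Proof.
rewrite {2}[u]tensXP !tensor_coeff_sum scaler_sumr; apply: eq_bigr => s _.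
by rewrite !tensor_coeffX scalerMnr.
Qed.

Fact tensor_scaleA a b u :
  tensor_scale a (tensor_scale b u) = tensor_scale (a * b) u.
Proof. by apply: tensor_coeffP => r; rewrite !tensor_coeffZ scalerA. Qed.

Fact tensor_scale1 : left_id 1 tensor_scale.
Proof.
by move=> u; apply: tensor_coeffP => r; rewrite tensor_coeffZ scale1r.
Qed.

Fact tensor_scaleDr : right_distributive tensor_scale +%R.
Proof.
by move=> a u v; apply: tensor_coeffP => r;
  rewrite !(mcoeffD, tensor_coeffZ) scalerDr.
Qed.

Fact tensor_scaleDl u : {morph tensor_scale^~ u : a b / a + b}.
Proof.
by move=> a b; apply: tensor_coeffP => r;
  rewrite !(mcoeffD, tensor_coeffZ) scalerDl.
Qed.

HB.instance Definition _ := GRing.Zmodule_isLmodule.Build K T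
  tensor_scaleA tensor_scale1 tensor_scaleDr tensor_scaleDl.

Lemma tensXZ a e r : tensX (a *: e) r = a *: tensX e r.
Proof.
by apply: tensor_coeffP => s;
  rewrite tensor_coeffZ !tensor_coeffX scalerMnr.
Qed.

Lemma tensX_is_linear r : linear (tensX^~ r).
Proof. by move=> a e f; rewrite tensX_is_additive tensXZ. Qed.

Lemma tensor_lieW (d d' : {fset G}) u v :
  msupp u `<=` d -> msupp v `<=` d' ->
  tensor_lie u v =
    \sum_(r <- d) \sum_(s <- d') tensX (lie u@_r v@_s) (r + s).
Proof.
move=> ud vd; rewrite /tensor_lie.
rewrite (@tensor_sumW _ (fun e r =>
  \sum_(s <- msupp v) tensX (lie e v@_s) (r + s)) u d) //; last first.
  by move=> r; rewrite big1 // => s _; rewrite lie0x tensX0.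
apply: eq_bigr => r _.
rewrite (@tensor_sumW _ (fun f s => tensX (lie u@_r f) (r + s)) v d') //.
by move=> s; rewrite liex0 tensX0.
Qed.

Fact tensor_lie_linearl a u v w :
  tensor_lie (a *: u + v) w = a *: tensor_lie u w + tensor_lie v w.
Proof.
pose d := msupp (a *: u + v) `|` msupp u `|` msupp v.
have le1 : msupp (a *: u + v) `<=` d.
  by rewrite /d -fsetUA fsubsetUl.
have le2 : msupp u `<=` d by rewrite /d fsubsetU // fsubsetUr.
have le3 : msupp v `<=` d by rewrite /d fsubsetUr.
rewrite (tensor_lieW le1 (fsubset_refl _)) (tensor_lieW le2 (fsubset_refl _)).
rewrite (tensor_lieW le3 (fsubset_refl _)) scaler_sumr -big_split /=.
apply: eq_bigr => r _; rewrite scaler_sumr -big_split /=.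
apply: eq_bigr => s _; rewrite mcoeffD [(a *: u)@_r]tensor_coeffZ.
by rewrite lieDl lieZl tensX_is_additive tensXZ.
Qed.

Fact tensor_lie_linearr a u v w :
  tensor_lie w (a *: u + v) = a *: tensor_lie w u + tensor_lie w v.
Proof.
pose d := msupp (a *: u + v) `|` msupp u `|` msupp v.
have le1 : msupp (a *: u + v) `<=` d.
  by rewrite /d -fsetUA fsubsetUl.
have le2 : msupp u `<=` d by rewrite /d fsubsetU // fsubsetUr.
have le3 : msupp v `<=` d by rewrite /d fsubsetUr.
rewrite (tensor_lieW (fsubset_refl _) le1) (tensor_lieW (fsubset_refl _) le2).
rewrite (tensor_lieW (fsubset_refl _) le3) scaler_sumr -big_split /=.
apply: eq_bigr => r _; rewrite scaler_sumr -big_split /=.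
apply: eq_bigr => s _; rewrite mcoeffD [(a *: u)@_s]tensor_coeffZ.
by rewrite lieDr lieZr tensX_is_additive tensXZ.
Qed.

Lemma tensor_lieX e f r s :
  tensor_lie (tensX e r) (tensX f s) = tensX (lie e f) (r + s).
Proof.
rewrite (tensor_lieW msuppU_le msuppU_le) !big_seq_fset1.
by rewrite !tensor_coeffX !eqxx !mulr1n.
Qed.

Local Lemma tensor_lieD u v w :
  (tensor_lie (u + v) w = tensor_lie u w + tensor_lie v w)
  * (tensor_lie w (u + v) = tensor_lie w u + tensor_lie w v).
Proof.
by split; [have := tensor_lie_linearl 1 u v w
          |have := tensor_lie_linearr 1 u v w]; rewrite !scale1r.
Qed.

Local Lemma tensor_lie0 u : (tensor_lie 0 u = 0) * (tensor_lie u 0 = 0).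
Proof.
by split; apply: (@addrI _ (tensor_lie 0 u + tensor_lie u 0));
  [rewrite addr0 addrAC -(tensor_lieD 0 0 u).1
  |rewrite addr0 -addrA -(tensor_lieD 0 0 u).2]; rewrite addr0.
Qed.

(* Additive properties of T hold as soon as they hold on the e (x) x^r. *)
Lemma tensX_ind (P : T -> Prop) :
  P 0 -> (forall u v, P u -> P v -> P (u + v)) ->
  (forall e r, P (tensX e r)) -> forall u, P u.
Proof. by move=> P0 PD PX u; rewrite [u]tensXP; apply: big_ind. Qed.

Local Lemma tensor_lieC u v : tensor_lie u v = - tensor_lie v u.
Proof.
elim/tensX_ind: u => [|u w|e r]; first by rewrite !tensor_lie0 oppr0.
  by rewrite !tensor_lieD opprD => -> ->.
elim/tensX_ind: v => [|v w|f s]; first by rewrite !tensor_lie0 oppr0.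
  by rewrite !tensor_lieD opprD => -> ->.
rewrite !tensor_lieX lieC addrC; apply: (@addIr _ (tensX (lie f e) (s + r))).
by rewrite -tensX_is_additive !addNr tensX0.
Qed.

Fact tensor_liexx u : tensor_lie u u = 0.
Proof.
elim/tensX_ind: u => [|u v uu vv|e r]; first by rewrite tensor_lie0.
  by rewrite !tensor_lieD uu vv add0r addr0 [X in _ + X]tensor_lieC subrr.
by rewrite tensor_lieX liexx tensX0.
Qed.

Fact tensor_lie_jacobi u v w :
  tensor_lie u (tensor_lie v w) + tensor_lie v (tensor_lie w u)
    + tensor_lie w (tensor_lie u v) = 0.
Proof.
have add6 (a b c a' b' c' : T) : a + b + c = 0 -> a' + b' + c' = 0 ->
  a + a' + (b + b') + (c + c') = 0.
  by move=> h h'; rewrite (addrACA a a') (addrACA (a + b)); rewrite h h' addr0.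
elim/tensX_ind: u => [|u1 u2|e r].
- by rewrite !tensor_lie0 !addr0.
- by rewrite !tensor_lieD; apply: add6.
elim/tensX_ind: v => [|v1 v2|f s].
- by rewrite !tensor_lie0 !addr0.
- by rewrite !tensor_lieD; apply: add6.
elim/tensX_ind: w => [|w1 w2|g t].
- by rewrite !tensor_lie0 !addr0.
- by rewrite !tensor_lieD; apply: add6.
rewrite !tensor_lieX (addrC s) -addrA (addrCA r) addrA.
rewrite [in X in _ + X](addrC r) !addrA.
rewrite (_ : s + t + r = t + s + r) 1?[s + t]addrC //.
by rewrite (addrAC t r s) -!tensX_is_additive lie_jacobi tensX0.
Qed.

HB.instance Definition _ := Lmodule_isLie.Build K T
  tensor_lie_linearl tensor_lie_linearr tensor_liexx tensor_lie_jacobi.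

Lemma lie_tensX e f r s :
  lie (tensX e r) (tensX f s) = tensX (lie e f) (r + s).
Proof. exact: tensor_lieX. Qed.

End TensorPowers.

Section TensorUniversal.
Context {K : fieldType} {L : lieAlgType K} {G : nmodType} {M : lmodType K}.
Variable phi : G -> {linear L -> M}.

Definition tens_lift (u : tensor_powers L G) : M :=
  \sum_(r <- msupp u) phi r u@_r.

Fact tens_lift_is_linear : linear tens_lift.
Proof.
move=> a u v; rewrite /tens_lift.
pose d := msupp (a *: u + v) `|` msupp u `|` msupp v.
pose phi' e r := phi r e.
have phi0 r : phi' 0 r = 0 by rewrite /phi' raddf0.
rewrite (@tensor_sumW K L G _ phi' (a *: u + v) d) //; last first.
  by rewrite /d -fsetUA fsubsetUl.
rewrite (@tensor_sumW K L G _ phi' u d) //; last first.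
  by rewrite /d fsubsetU // fsubsetUr.
rewrite (@tensor_sumW K L G _ phi' v d) // ?fsubsetUr //.
rewrite scaler_sumr -big_split /=; apply: eq_bigr => r _.
by rewrite /phi' mcoeffD [(a *: u)@_r]tensor_coeffZ linearP.
Qed.

HB.instance Definition _ :=
  GRing.isLinear.Build K (tensor_powers L G) M _ tens_lift tens_lift_is_linear.

Lemma tens_liftX e r : tens_lift (tensX e r) = phi r e.
Proof.
rewrite /tens_lift (@tensor_sumW K L G _ (fun e r => phi r e) _ [fset r]).
- by rewrite big_seq_fset1 tensor_coeffX eqxx.
- by move=> s; rewrite raddf0.
- exact: msuppU_le.
Qed.

Lemma tensX_universal :
  exists Phi : {linear tensor_powers L G -> M},
    (forall e r, Phi (tensX e r) = phi r e)
    /\ forall Psi : {linear tensor_powers L G -> M},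
         (forall e r, Psi (tensX e r) = phi r e) -> Psi =1 Phi.
Proof.
exists tens_lift; split=> [|Psi PsiX]; first exact: tens_liftX.
apply: tensX_ind => [|u v pu pv|e r]; first by rewrite !raddf0.
  by rewrite !raddfD /= pu pv.
by rewrite PsiX /= tens_liftX.
Qed.

End TensorUniversal.

Definition current_algebra (K : fieldType) (L : lieAlgType K) :
  lieAlgType K := tensor_powers L nat.

Definition loop_algebra (K : fieldType) (L : lieAlgType K) :
  lieAlgType K := tensor_powers L int.

(* -------------------------------------------------------------------- *)
Definition free_algebra (K : fieldType) (I : choiceType) :=
  {malg K[{fmonom I}]}.

Section FreeAlgebra.
Context {K : fieldType} {I : choiceType}.
Local Notation F := (free_algebra K I).

HB.instance Definition _ := GRing.NzRing.on F.
HB.instance Definition _ := GRing.Lalgebra.on F.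

Lemma free_scaleE (a : K) (u : F) : a *: u = a%:MP * u.
Proof. exact: (esym (mul_malgC a u)). Qed.

Lemma free_mulCr (a : K) (u : F) : u * a%:MP = a%:MP * u.
Proof.
rewrite !malgM_def fgmulUg fgmulgU; apply: eq_bigr => m _.
by rewrite mulrC mul1m mulm1.
Qed.

Fact free_scalerAr (a : K) (u v : F) : a *: (u * v) = u * (a *: v).
Proof. by rewrite !free_scaleE [RHS]mulrA free_mulCr -[RHS]mulrA. Qed.

HB.instance Definition _ := GRing.Lalgebra_isAlgebra.Build K F free_scalerAr.

Definition fgen (x : I) : F := << fmu x >>.

Lemma free_ind (P : F -> Prop) :
  (forall a : K, P a%:A) -> (forall u v, P u -> P v -> P (u + v)) ->
  (forall u v, P u -> P v -> P (u * v)) ->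
  (forall x, P (fgen x)) -> forall u, P u.
Proof.
move=> PA PD PM PX u; rewrite [u]monalgE.
apply: big_ind => // [|m _]; first by rewrite -(scale0r 1); apply: PA.
have -> : << u@_m *g m >> = (u@_m)%:A * << m >> :> F.
  by rewrite -mul_malgC mulr1 malgM_def fgmulUU mulr1 mul1m.
apply: (PM) => //; case: m => s; elim: s => [|x s IHs].
  by have := PA 1; rewrite scale1r /GRing.one /= /fgone /mone /= fmoneE.
rewrite (_ : << _ >> = fgen x * << FMonom s >>); first exact: PM.
rewrite malgM_def fgmulUU mulr1; congr mkmalgU.
by rewrite /mmul /= fmmulE fmuE.
Qed.

Section Eval.
Context {B : algType K} (f : I -> B).

Definition fword (m : {fmonom I}) : B := \prod_(x <- (m : seq I)) f x.

Fact fword_mmorphism : mmorphism fword.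
Proof.
split=> [m n|]; rewrite /fword; first by rewrite fmM big_cat.
by rewrite fm1 big_nil.
Qed.

HB.instance Definition _ := isMultiplicative.Build _ _ fword fword_mmorphism.

Definition feval (u : F) : B := mmap (in_alg B) fword u.

Fact feval_linear : linear feval.
Proof.
move=> a u v; rewrite /feval raddfD /=; congr (_ + _).
by rewrite (mmapZ (f := in_alg B) (h := fword)) /= mulr_algl.
Qed.

Fact feval_monoid_morphism : monoid_morphism feval.
Proof.
have [|m1 mM] := @commr_mmap_is_multiplicative _ _ _ (in_alg B) fword.
  by move=> g m m'; rewrite /GRing.comm mulr_algl mulr_algr.
by split.
Qed.

HB.instance Definition _ := GRing.isLinear.Build K F B _ feval feval_linear.
HB.instance Definition _ :=
  GRing.isMonoidMorphism.Build F B feval feval_monoid_morphism.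

Lemma feval_gen x : feval (fgen x) = f x.
Proof. by rewrite /feval mmapU /= scale1r mul1r /fword fmU big_seq1. Qed.

End Eval.
End FreeAlgebra.

(* -------------------------------------------------------------------- *)
Definition two_sided_ideal (A : pzRingType) (J : set A) : Prop :=
  [/\ J 0, forall u v, J u -> J v -> J (u - v)
    & forall a u b, J u -> J (a * u * b)].

Section QuotientAlgebra.
Context {K : fieldType} {A : algType K} {J : set A}.
Hypotheses (idJ : two_sided_ideal J) (J1 : ~ J 1).

Local Lemma ideal0 : J 0. Proof. by case: idJ. Qed.
Local Lemma idealB u v : J u -> J v -> J (u - v).
Proof. by case: idJ => _ + _; apply. Qed.
Local Lemma idealN u : J u -> J (- u).
Proof. by move=> Ju; rewrite -sub0r; apply: idealB => //; apply: ideal0. Qed.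
Local Lemma idealD u v : J u -> J v -> J (u + v).
Proof.
by move=> Ju Jv; rewrite -[v]opprK; apply: idealB => //; apply: idealN.
Qed.
Local Lemma idealMl a u : J u -> J (a * u).
Proof. by rewrite -[a * u]mulr1; case: idJ => _ _; apply. Qed.
Local Lemma idealMr u b : J u -> J (u * b).
Proof. by rewrite -[u * b]mul1r mulrA; case: idJ => _ _; apply. Qed.

Definition quot_equiv (u v : A) : bool := `[< J (u - v) >].

Fact quot_equiv_refl : reflexive quot_equiv.
Proof. by move=> u; apply/asboolP; rewrite subrr; apply: ideal0. Qed.

Fact quot_equiv_sym : symmetric quot_equiv.
Proof. by move=> u v; apply/asboolP/asboolP => /idealN; rewrite opprB. Qed.

Fact quot_equiv_trans : transitive quot_equiv.
Proof.
move=> v u w /asboolP uv /asboolP vw; apply/asboolP.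
by have := idealD uv vw; rewrite subrKA.
Qed.

Canonical quot_equiv_rel :=
  EquivRel quot_equiv quot_equiv_refl quot_equiv_sym quot_equiv_trans.

Definition quot_alg (_ : ~ J 1) := {eq_quot quot_equiv}%qT.
Local Notation Q := (quot_alg J1).

HB.instance Definition _ := Choice.on Q.
HB.instance Definition _ := EqQuotient.on Q.

Local Open Scope quotient_scope.

Definition quot_proj (u : A) : Q := \pi u.

Lemma quot_projP u v : quot_proj u = quot_proj v <-> J (u - v).
Proof.
split=> [/eqP|uv]; first by rewrite /quot_proj piE => /asboolP.
by apply/eqP; rewrite /quot_proj piE; apply/asboolP.
Qed.

Lemma quot_proj_surj x : exists u, quot_proj u = x.
Proof. by exists (repr x); apply: reprK. Qed.

Lemma quot_proj_ind (P : Q -> Prop) :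
  (forall u : A, P (quot_proj u)) -> forall x, P x.
Proof. by move=> PF x; have [u <-] := quot_proj_surj x. Qed.

Local Lemma quot_reprP u : J (u - repr (quot_proj u)).
Proof. by apply/quot_projP; rewrite /quot_proj reprK. Qed.

Definition quot_zero := quot_proj 0.
Definition quot_one := quot_proj 1.
Definition quot_opp (x : Q) : Q := quot_proj (- repr x).
Definition quot_add (x y : Q) : Q := quot_proj (repr x + repr y).
Definition quot_mul (x y : Q) : Q := quot_proj (repr x * repr y).
Definition quot_scale (a : K) (x : Q) : Q := quot_proj (a *: repr x).

Local Lemma quot_oppE u : quot_opp (quot_proj u) = quot_proj (- u).
Proof.
rewrite /quot_opp; apply: esym; apply/quot_projP; rewrite -opprD.
by apply: idealN; exact: quot_reprP.
Qed.

Local Lemma quot_addE u v :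
  quot_add (quot_proj u) (quot_proj v) = quot_proj (u + v).
Proof.
rewrite /quot_add; apply: esym; apply/quot_projP; rewrite opprD addrACA.
by apply: idealD; exact: quot_reprP.
Qed.

Local Lemma quot_mulE u v :
  quot_mul (quot_proj u) (quot_proj v) = quot_proj (u * v).
Proof.
rewrite /quot_mul; apply: esym; apply/quot_projP.
rewrite -(subrKA (repr (quot_proj u) * v)).
by rewrite -mulrBl -mulrBr; apply: idealD;
  [apply: idealMr|apply: idealMl]; exact: quot_reprP.
Qed.

Local Lemma quot_scaleE a u : quot_scale a (quot_proj u) = quot_proj (a *: u).
Proof.
rewrite /quot_scale; apply: esym; apply/quot_projP.
by rewrite -scalerBr -mulr_algl; apply: idealMl; exact: quot_reprP.
Qed.

Fact quot_addA : associative quot_add.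
Proof.
by elim/quot_proj_ind=> u; elim/quot_proj_ind=> v; elim/quot_proj_ind=> w;
  rewrite !quot_addE addrA.
Qed.
Fact quot_addC : commutative quot_add.
Proof.
by elim/quot_proj_ind=> u; elim/quot_proj_ind=> v; rewrite !quot_addE addrC.
Qed.
Fact quot_add0 : left_id quot_zero quot_add.
Proof. by elim/quot_proj_ind=> u; rewrite quot_addE add0r. Qed.
Fact quot_addN : left_inverse quot_zero quot_opp quot_add.
Proof. by elim/quot_proj_ind=> u; rewrite quot_oppE quot_addE addNr. Qed.

HB.instance Definition _ := GRing.isZmodule.Build Q
  quot_addA quot_addC quot_add0 quot_addN.

Fact quot_mulA : associative quot_mul.
Proof.
by elim/quot_proj_ind=> u; elim/quot_proj_ind=> v; elim/quot_proj_ind=> w;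
  rewrite !quot_mulE mulrA.
Qed.
Fact quot_mul1 : left_id quot_one quot_mul.
Proof. by elim/quot_proj_ind=> u; rewrite quot_mulE mul1r. Qed.
Fact quot_mulr1 : right_id quot_one quot_mul.
Proof. by elim/quot_proj_ind=> u; rewrite quot_mulE mulr1. Qed.
Fact quot_mulDl : left_distributive quot_mul quot_add.
Proof.
by elim/quot_proj_ind=> u; elim/quot_proj_ind=> v; elim/quot_proj_ind=> w;
  rewrite !(quot_addE, quot_mulE) mulrDl.
Qed.
Fact quot_mulDr : right_distributive quot_mul quot_add.
Proof.
by elim/quot_proj_ind=> u; elim/quot_proj_ind=> v; elim/quot_proj_ind=> w;
  rewrite !(quot_addE, quot_mulE) mulrDr.
Qed.
Fact quot_1neq0 : quot_one != quot_zero.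
Proof.
by apply/eqP => /quot_projP; rewrite subr0; apply: J1.
Qed.

HB.instance Definition _ := GRing.Zmodule_isNzRing.Build Q
  quot_mulA quot_mul1 quot_mulr1 quot_mulDl quot_mulDr quot_1neq0.

Fact quot_scaleA a b x : quot_scale a (quot_scale b x) = quot_scale (a * b) x.
Proof. by elim/quot_proj_ind: x => u; rewrite !quot_scaleE scalerA. Qed.
Fact quot_scale1 : left_id 1 quot_scale.
Proof. by elim/quot_proj_ind=> u; rewrite quot_scaleE scale1r. Qed.
Fact quot_scaleDr : right_distributive quot_scale +%R.
Proof.
move=> a; elim/quot_proj_ind=> u; elim/quot_proj_ind=> v.
rewrite -[_ + _]/(quot_add _ _) -[RHS]/(quot_add _ _).
by rewrite !(quot_addE, quot_scaleE) scalerDr.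
Qed.
Fact quot_scaleDl x : {morph quot_scale^~ x : a b / a + b}.
Proof.
elim/quot_proj_ind: x => u a b.
by rewrite -[RHS]/(quot_add _ _) !(quot_addE, quot_scaleE) scalerDl.
Qed.

HB.instance Definition _ := GRing.Zmodule_isLmodule.Build K Q
  quot_scaleA quot_scale1 quot_scaleDr quot_scaleDl.

Fact quot_scaleAl (a : K) (x y : Q) : a *: (x * y) = a *: x * y.
Proof.
elim/quot_proj_ind: x => u; elim/quot_proj_ind: y => v.
rewrite -[LHS]/(quot_scale _ (quot_mul _ _)).
rewrite -[RHS]/(quot_mul (quot_scale _ _) _).
by rewrite !(quot_mulE, quot_scaleE) scalerAl.
Qed.

HB.instance Definition _ :=
  GRing.Lmodule_isLalgebra.Build K Q quot_scaleAl.

Fact quot_scaleAr (a : K) (x y : Q) : a *: (x * y) = x * (a *: y).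
Proof.
elim/quot_proj_ind: x => u; elim/quot_proj_ind: y => v.
rewrite -[LHS]/(quot_scale _ (quot_mul _ _)).
rewrite -[RHS]/(quot_mul _ (quot_scale _ _)).
by rewrite !(quot_mulE, quot_scaleE) scalerAr.
Qed.

HB.instance Definition _ :=
  GRing.Lalgebra_isAlgebra.Build K Q quot_scaleAr.

Fact quot_proj_linear : linear quot_proj.
Proof.
by move=> a u v; rewrite -[RHS]/(quot_add (quot_scale _ _) _)
  quot_scaleE quot_addE.
Qed.

Fact quot_proj_monoid_morphism : monoid_morphism quot_proj.
Proof. by split=> // u v; rewrite -[RHS]/(quot_mul _ _) quot_mulE. Qed.

HB.instance Definition _ :=
  GRing.isLinear.Build K A Q _ quot_proj quot_proj_linear.
HB.instance Definition _ :=
  GRing.isMonoidMorphism.Build A Q quot_proj quot_proj_monoid_morphism.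

Section Lift.
Context {B : algType K} (f : {lrmorphism A -> B}).
Hypothesis fJ : forall u, J u -> f u = 0.

Definition quot_lift (_ : forall u, J u -> f u = 0) (x : Q) : B := f (repr x).
Local Notation lift := (quot_lift fJ).

Lemma quot_liftE u : lift (quot_proj u) = f u.
Proof.
by apply/esym/eqP; rewrite -subr_eq0 -raddfB /= fJ //; exact: quot_reprP.
Qed.

Fact quot_lift_linear : linear lift.
Proof.
move=> a; elim/quot_proj_ind=> u; elim/quot_proj_ind=> v.
by rewrite -linearP !quot_liftE linearP.
Qed.

Fact quot_lift_monoid_morphism : monoid_morphism lift.
Proof.
split; first by rewrite -(rmorph1 quot_proj) quot_liftE rmorph1.
elim/quot_proj_ind=> u; elim/quot_proj_ind=> v.
by rewrite -rmorphM !quot_liftE rmorphM.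
Qed.

HB.instance Definition _ :=
  GRing.isLinear.Build K Q B _ lift quot_lift_linear.
HB.instance Definition _ := GRing.isMonoidMorphism.Build Q B lift
  quot_lift_monoid_morphism.

End Lift.
End QuotientAlgebra.

(* -------------------------------------------------------------------- *)
Section Enveloping.
Context {K : fieldType} {L : lieAlgType K}.
Local Notation F := (free_algebra K L).

Variant env_rel : F -> Prop :=
| EnvLinear (a : K) (x y : L) :
    env_rel (fgen (a *: x + y) - (a *: fgen x + fgen y))
| EnvBracket (x y : L) :
    env_rel (fgen x * fgen y - fgen y * fgen x - fgen (lie x y)).

(* The free algebra on the set L modulo the relations EnvLinear is the tensor
   algebra of L; modulo EnvBracket also, it is the enveloping algebra. *)
Definition env_ideal : set F := fun u =>
  forall J : set F, two_sided_ideal J -> (forall v, env_rel v -> J v) -> J u.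

Lemma env_ideal_two_sided : two_sided_ideal env_ideal.
Proof.
split=> [J [] //|u v Ju Jv J idJ rJ|a u b Ju J idJ rJ].
  by case: (idJ) => _ + _; apply; [apply: Ju|apply: Jv].
by case: (idJ) => _ _; apply; apply: Ju.
Qed.

Lemma env_ideal_rel u : env_rel u -> env_ideal u.
Proof. by move=> ru J _; apply. Qed.

Lemma env_ideal_feval (B : algType K) (f : {linear L -> B}) :
  (forall x y, f (lie x y) = f x * f y - f y * f x) ->
  forall u, env_ideal u -> feval f u = 0.
Proof.
move=> fL u Iu; apply: (Iu (fun v => feval f v = 0)).
  split=> [|v w v0 w0|a v b v0].
  - exact: raddf0.
  - by rewrite raddfB /= v0 w0 subr0.
  - by rewrite !rmorphM /= v0 mulr0 mul0r.
move=> _ [a x y|x y].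
  by rewrite linearB linearP /= !feval_gen linearP subrr.
have fM z t : feval f (fgen z * fgen t) = f z * f t.
  by rewrite (feval_monoid_morphism f).2 2!feval_gen.
by rewrite 2!linearB
  [X in X - _ - _]fM [X in _ - X - _]fM /= feval_gen fL subrr.
Qed.

Lemma env_ideal_proper : ~ env_ideal 1.
Proof.
pose f : {linear L -> K^o} := \0.
have f0 x y : f (lie x y) = f x * f y - f y * f x by rewrite /= mulr0 subrr.
by move/(env_ideal_feval f0)/eqP; rewrite rmorph1 oner_eq0.
Qed.

Definition enveloping : algType K :=
  quot_alg env_ideal_two_sided env_ideal_proper.

Definition env_proj : {lrmorphism F -> enveloping} :=
  quot_proj env_ideal_two_sided env_ideal_proper.

Lemma env_projP u v : env_proj u = env_proj v <-> env_ideal (u - v).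
Proof. exact: quot_projP. Qed.

Lemma env_proj_surj x : exists u, env_proj u = x.
Proof. exact: quot_proj_surj. Qed.

Definition env_inj (x : L) : enveloping := env_proj (fgen x).

Fact env_inj_linear : linear env_inj.
Proof.
move=> a x y; rewrite /env_inj -linearP; apply/env_projP.
by apply: env_ideal_rel; exact: EnvLinear.
Qed.

HB.instance Definition _ :=
  GRing.isLinear.Build K L enveloping _ env_inj env_inj_linear.

Lemma env_inj_lie x y :
  env_inj (lie x y) = env_inj x * env_inj y - env_inj y * env_inj x.
Proof.
rewrite /env_inj -!rmorphM -raddfB; apply: esym; apply/env_projP.
by apply: env_ideal_rel; exact: EnvBracket.
Qed.

Lemma env_ind (P : enveloping -> Prop) :
  (forall a : K, P a%:A) -> (forall u v, P u -> P v -> P (u + v)) ->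
  (forall u v, P u -> P v -> P (u * v)) ->
  (forall x, P (env_inj x)) -> forall u, P u.
Proof.
move=> PA PD PM PX x; have [u <-] := env_proj_surj x.
move: u; apply: free_ind => [a|u v|u v|y].
- by rewrite linearZ rmorph1; exact: PA.
- by rewrite raddfD; apply: PD.
- by rewrite rmorphM; apply: PM.
- exact: PX.
Qed.

Section Lift.
Context {B : algType K} (f : {linear L -> B}).
Hypothesis fL : forall x y, f (lie x y) = f x * f y - f y * f x.

Lemma env_universal :
  exists Phi : {lrmorphism enveloping -> B},
    (forall x, Phi (env_inj x) = f x)
    /\ forall Psi : {lrmorphism enveloping -> B},
         (forall x, Psi (env_inj x) = f x) -> Psi =1 Phi.
Proof.
pose ev : {lrmorphism F -> B} := feval f.
have ev0 : forall u, env_ideal u -> ev u = 0 := env_ideal_feval fL.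
pose Phi : {lrmorphism enveloping -> B} := quot_lift ev0.
have PhiE x : Phi (env_inj x) = f x.
  by rewrite -(feval_gen f x); exact: quot_liftE.
exists Phi; split=> // Psi PsiE; apply: env_ind => [a|u v Pu Pv|u v Pu Pv|x].
- by rewrite !rmorph_alg.
- by rewrite [LHS]raddfD [RHS]raddfD /= Pu Pv.
- by rewrite [LHS]rmorphM [RHS]rmorphM /= Pu Pv.
- by rewrite PsiE PhiE.
Qed.

End Lift.
End Enveloping.

Arguments enveloping {K} L.

(* -------------------------------------------------------------------- *)
Local Open Scope classical_set_scope.

Definition center (A : pzRingType) : set A :=
  [set z | forall u : A, z * u = u * z].

Definition scalars (K : pzRingType) (A : algType K) : set A :=
  range (fun a : K => a%:A).

Arguments center : clear implicits.
Arguments scalars {K} A.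

(* Main.v *)
(* The argument works on leading terms for the length filtration of U(g), but
   avoids PBW.  Since l has trivial centre, it has a faithful matrix
   representation rho (the adjoint one).  For pairwise distinct nonzero points
   a_1, ..., a_m the maps x |-> rho(x(a_k)), acting on m different tensor
   factors, give an algebra morphism Phi from U(g) to a tensor product of m
   matrix algebras.  Applying to the k-th factor a linear form
   M |-> [rho(e_k), M]_ij, which kills 1, gives a functional F on U(g) which
   vanishes on words of length < m and sends x_1 ... x_m to the permanent of
   the matrix of the rho([e_k, x_l(a_k)])_ij.
   If z is central, then F(z) = 0: choose y in g with y(a_1) = e_1 and
   y(a_k) = 0 for k > 1; then Phi(y) is rho(e_1) in the first factor, and it
   commutes with Phi(z).  On the other hand these permanents determine the
   symmetrized leading term of z, because a polynomial with infinitely many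
   zeros vanishes and because l has trivial centre.  So the leading term of z
   is zero as soon as its degree m is positive; dividing by m! uses
   characteristic 0. *)
Require Import Defs.
From HB Require Import structures.
From mathcomp Require Import all_boot all_algebra.
From mathcomp Require Import finmap monalg.
From mathcomp Require Import classical_sets.
Import GRing.Theory.

Set Implicit Arguments.
Unset Strict Implicit.
Unset Printing Implicit Defensive.

Local Open Scope fset_scope.
Local Open Scope ring_scope.

(** * Removing one letter from a word *)

Section Picks.
Context {X : eqType}.
Implicit Types (x : X) (s : seq X).

Fixpoint picks s : seq (X * seq X) :=
  if s is x :: s' then (x, s') :: [seq (q.1, x :: q.2) | q <- picks s']
  else [::].

Lemma size_picks s : size (picks s) = size s.
Proof. by elim: s => //= x s IH; rewrite size_map IH. Qed.

Lemma size_pick s q : q \in picks s -> size s = (size q.2).+1.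
Proof.
elim: s q => //= x s IH q; rewrite inE => /predU1P[-> //|/mapP[q' q'P ->] /=].
by rewrite (IH _ q'P).
Qed.

End Picks.

(* An alias, as a K-algebra structure on 'M[B]_n.+1 would conflict with its
   B-module structure. *)
Definition mx_alg (K : fieldType) (B : algType K) (n : nat) := 'M[B]_n.+1.

(** * Matrices over [B] as an algebra over [K] *)

Section MatrixAlgebra.
Context {K : fieldType} {B : algType K} {n : nat}.
Local Notation M := (mx_alg B n).

HB.instance Definition _ := GRing.NzRing.on M.

Definition mx_alg_scale (a : K) (u : M) : M := \matrix_(i, j) (a *: u i j).

Fact mx_alg_scaleA a b u :
  mx_alg_scale a (mx_alg_scale b u) = mx_alg_scale (a * b) u.
Proof. by apply/matrixP => i j; rewrite !mxE scalerA. Qed.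
Fact mx_alg_scale1 : left_id 1 mx_alg_scale.
Proof. by move=> u; apply/matrixP => i j; rewrite !mxE scale1r. Qed.
Fact mx_alg_scaleDr : right_distributive mx_alg_scale +%R.
Proof. by move=> a u v; apply/matrixP => i j; rewrite !mxE scalerDr. Qed.
Fact mx_alg_scaleDl u : {morph mx_alg_scale^~ u : a b / a + b}.
Proof. by move=> a b; apply/matrixP => i j; rewrite !mxE scalerDl. Qed.

HB.instance Definition _ := GRing.Zmodule_isLmodule.Build K M
  mx_alg_scaleA mx_alg_scale1 mx_alg_scaleDr mx_alg_scaleDl.

Fact mx_alg_scaleAl (a : K) (u v : M) : a *: (u * v) = a *: u * v.
Proof.
apply/matrixP => i j; rewrite !mxE scaler_sumr; apply: eq_bigr => k _.
by rewrite !mxE scalerAl.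
Qed.
HB.instance Definition _ := GRing.Lmodule_isLalgebra.Build K M mx_alg_scaleAl.

Fact mx_alg_scaleAr (a : K) (u v : M) : a *: (u * v) = u * (a *: v).
Proof.
apply/matrixP => i j; rewrite !mxE scaler_sumr; apply: eq_bigr => k _.
by rewrite !mxE scalerAr.
Qed.
HB.instance Definition _ := GRing.Lalgebra_isAlgebra.Build K M mx_alg_scaleAr.

End MatrixAlgebra.

(** * The length filtration *)

Section WordSpan.
Context {K : fieldType} {L : choiceType} {B : algType K} (psi : L -> B).
Implicit Types (P Q : pred nat) (b : B) (w : seq L).

(** Described by generation, as [B] may have infinite dimension; a predicate on lengths covers
    [k < m] and [k.+2 <= size xs] alike. *)
Inductive wspan P : B -> Prop :=
| wspan0 : wspan P 0
| wspanD b b' : wspan P b -> wspan P b' -> wspan P (b + b')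
| wspanW (a : K) w : P (size w) -> wspan P (a *: \prod_(x <- w) psi x).

Lemma wspan_word P w : P (size w) -> wspan P (\prod_(x <- w) psi x).
Proof. by rewrite -[\prod_(x <- _) _]scale1r; apply: wspanW. Qed.

Lemma wspanZ P a b : wspan P b -> wspan P (a *: b).
Proof.
elim=> [|c c' _ IHc _ IHc'|a' w Pw]; rewrite ?scaler0 ?scalerDr ?scalerA.
- exact: wspan0.
- exact: wspanD.
- exact: wspanW.
Qed.

Lemma wspanB P b b' : wspan P b -> wspan P b' -> wspan P (b - b').
Proof.
by move=> Pb Pb'; rewrite -scaleN1r; apply: wspanD => //; apply: wspanZ.
Qed.

Lemma wspan_sum P (I : eqType) (r : seq I) (F : I -> B) :
  (forall i, i \in r -> wspan P (F i)) -> wspan P (\sum_(i <- r) F i).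
Proof.
move=> PF; rewrite big_seq; apply: big_ind => //; first exact: wspan0.
exact: wspanD.
Qed.

Lemma wspanM P Q b b' (R : pred nat) : wspan P b -> wspan Q b' ->
  (forall k l, P k -> Q l -> R (k + l)%N) -> wspan R (b * b').
Proof.
move=> Pb Qb' PQR; elim: Pb => [|c c' _ IHc _ IHc'|a w Pw].
- by rewrite mul0r; exact: wspan0.
- by rewrite mulrDl; exact: wspanD.
elim: Qb' => [|c c' _ IHc _ IHc'|a' w' Qw'].
- by rewrite mulr0; exact: wspan0.
- by rewrite mulrDr; exact: wspanD.
rewrite -scalerAl -scalerAr scalerA -big_cat; apply: wspanW.
by rewrite size_cat; apply: PQR.
Qed.

Lemma wspanMl P Q b x : wspan P b -> (forall k, P k -> Q k.+1) ->
  wspan Q (psi x * b).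
Proof.
move=> Pb PQ; apply: (@wspanM (pred1 1%N) P) => //;
  last by move=> k l /eqP-> /PQ.
by have := @wspan_word (pred1 1%N) [:: x] isT; rewrite big_seq1.
Qed.

Lemma wspan_sub P Q b : wspan P b -> (forall k, P k -> Q k) -> wspan Q b.
Proof.
move=> Pb PQ; rewrite -[b]mul1r; apply: (wspanM (P := pred1 0) _ Pb).
  by have := @wspan_word (pred1 0) [::] isT; rewrite big_nil.
by move=> k l /eqP-> /PQ.
Qed.

End WordSpan.

(** * Adjoining one matrix tensor factor *)

Definition lie_morph (K : fieldType) (L : lieAlgType K) (B : algType K)
    (f : L -> B) : Prop :=
  forall x y, f (lie x y) = f x * f y - f y * f x.

Section MatrixExtension.
Context {K : fieldType} {L : lieAlgType K} {B : algType K} {n : nat}.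
Context (psi : {linear L -> B}) (rho : {linear L -> 'M[K]_n.+1}).
Implicit Types (x y : L) (xs : seq L) (M N : 'M[K]_n.+1) (b : B).

Definition const_mx_alg M : mx_alg B n := map_mx (in_alg B) M.
Definition scalar_mx_alg b : mx_alg B n := b%:M.
Local Notation cmx := const_mx_alg.
Local Notation smx := scalar_mx_alg.

Lemma cmxM M N : cmx (M * N) = cmx M * cmx N.
Proof. exact: map_mxM. Qed.
Lemma smxM b b' : smx (b * b') = smx b * smx b'.
Proof. exact: scalar_mxM. Qed.

Lemma cmx_smxC M b : cmx M * smx b = smx b * cmx M.
Proof.
rewrite /scalar_mx_alg -diag_const_mx -!mulmxE; apply/matrixP => i j.
by rewrite mul_mx_diag mul_diag_mx !mxE mulr_algl mulr_algr.
Qed.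

Lemma smx_cmxE b M i j : (smx b * cmx M) i j = M i j *: b.
Proof. by rewrite /scalar_mx_alg -mulmxE mul_scalar_mx !mxE mulr_algr. Qed.

(** Viewing [mx_alg B n] as the tensor product of [B] with a matrix algebra, this is the tensor
    product of the representations [psi] and [rho]. *)
Definition mx_ext x : mx_alg B n := cmx (rho x) + smx (psi x).

Fact mx_ext_linear : linear mx_ext.
Proof.
move=> a x y; apply/matrixP => i j; rewrite !mxE !linearP /= !mxE.
by rewrite mulrnDl scalerDl scalerMnr [in RHS]scalerA (mulrC (rho x i j))
  addrACA.
Qed.
HB.instance Definition _ :=
  GRing.isLinear.Build K L (mx_alg B n) _ mx_ext mx_ext_linear.

Lemma mx_ext_lie : lie_morph psi -> lie_morph rho -> lie_morph mx_ext.
Proof.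
move=> psiL rhoL x y; rewrite /mx_ext psiL rhoL.
have -> : cmx (rho x * rho y - rho y * rho x) =
  cmx (rho x) * cmx (rho y) - cmx (rho y) * cmx (rho x).
  by rewrite -!cmxM; exact: (raddfB (map_mx (in_alg B))).
have -> : smx (psi x * psi y - psi y * psi x) =
  smx (psi x) * smx (psi y) - smx (psi y) * smx (psi x).
  by rewrite -!smxM; exact: (raddfB (@scalar_mx B n.+1)).
(* Here [p] and [q] are the mixed products, which cancel because the two tensor factors commute. *)
have aux (V : zmodType) (u u' v v' p q : V) :
    u - u' + (v - v') = u + p + (q + v) - (u' + q + (p + v')).
  apply: esym; rewrite (addrACA u') opprD addrACA (addrC u') addrKA.
  by rewrite (addrC q v) addrKA.
rewrite !mulrDl !mulrDr !(cmx_smxC (rho x)) !(cmx_smxC (rho y)).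
exact: aux.
Qed.

(** In the expanded product each letter goes to [psi] or to [rho]. The terms are sorted by the
    number of letters sent to [rho]: none, exactly one, or at least two, the last being collected in
    [R]. *)
Lemma prod_mx_ext xs : exists2 R : mx_alg B n,
  forall i j, wspan psi (fun k => (k.+2 <= size xs)%N) (R i j) &
  \prod_(x <- xs) mx_ext x = smx (\prod_(x <- xs) psi x)
    + \sum_(q <- picks xs) cmx (rho q.1) * smx (\prod_(x <- q.2) psi x) + R.
Proof.
elim: xs => [|x xs [R RP IH]].
  exists 0; first by move=> i j; rewrite mxE; exact: wspan0.
  by rewrite !big_nil !addr0.
pose S := \sum_(q <- picks xs) cmx (rho q.1) * smx (\prod_(x <- q.2) psi x).
exists (cmx (rho x) * (S + R) + smx (psi x) * R).
  have SP i j : wspan psi (fun k => (k.+1 <= size xs)%N) (S i j).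
    rewrite summxE; apply: wspan_sum => q /size_pick sq.
    rewrite cmx_smxC mxE; apply: wspan_sum => k _.
    rewrite !mxE mulr_algr; apply: wspanZ.
    case: (_ == _); last exact: wspan0.
    by apply: wspan_word; rewrite /= sq.
  move=> i j; rewrite mxE; apply: wspanD.
    rewrite mxE; apply: wspan_sum => k _; rewrite !mxE mulr_algl.
    apply: wspanZ; apply: wspanD; first exact: SP.
    by apply: wspan_sub (RP _ _) _ => l /ltnW.
  rewrite /scalar_mx_alg -mulmxE mul_scalar_mx mxE.
  by apply: wspanMl (RP _ _) _.
rewrite !big_cons big_map /= IH -/S.
have -> : \sum_(q <- picks xs)
    cmx (rho q.1) * smx (\prod_(y <- x :: q.2) psi y) = smx (psi x) * S.
  rewrite mulr_sumr; apply: eq_bigr => q _.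
  by rewrite big_cons smxM mulrA cmx_smxC -mulrA.
rewrite /mx_ext mulrDl !mulrDr smxM !addrA.
by rewrite [LHS](ACl (4*1*5*2*3*6)).
Qed.

Section Functional.
Context (E : {linear B -> K^o}) (C : 'M[K]_n.+1) (i j : 'I_n.+1).

Definition mx_ext_form (M : mx_alg B n) : K^o :=
  E ((cmx C * M - M * cmx C) i j).

Fact mx_ext_form_linear : linear mx_ext_form.
Proof.
move=> a M N; rewrite /mx_ext_form -linearP; congr (E _).
rewrite mulrDl mulrDr -scalerAr -scalerAl opprD addrACA -scalerBr.
by rewrite mxE [X in X + _ = _]mxE.
Qed.
HB.instance Definition _ :=
  GRing.isLinear.Build K (mx_alg B n) K^o _ mx_ext_form mx_ext_form_linear.

Lemma mx_ext_form_comm (M : mx_alg B n) : cmx C * M = M * cmx C ->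
  mx_ext_form M = 0.
Proof. by move=> cM; rewrite /mx_ext_form cM subrr mxE raddf0. Qed.

(** In the decomposition of [prod_mx_ext], the term without matrix letters commutes with [cmx C] and
    the entries of [R] are killed by [E]; the middle sum remains. *)
Lemma mx_ext_form_prod xs :
  (forall ys, ((size ys).+1 < size xs)%N -> E (\prod_(x <- ys) psi x) = 0) ->
  mx_ext_form (\prod_(x <- xs) mx_ext x) =
    \sum_(q <- picks xs)
      (C * rho q.1 - rho q.1 * C) i j * E (\prod_(x <- q.2) psi x).
Proof.
move=> E0; have [R RP ->] := prod_mx_ext xs.
rewrite !linearD /= raddf_sum /=.
rewrite mx_ext_form_comm ?cmx_smxC // add0r.
have EW b : wspan psi (fun k => (k.+2 <= size xs)%N) b -> E b = 0.
  elim=> [|b1 b2 _ IH1 _ IH2|a w sw]; first exact: raddf0.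
    by rewrite raddfD /= IH1 IH2 addr0.
  by rewrite linearZ /= E0 // scaler0.
rewrite [X in _ + X](_ : _ = 0) ?addr0; last first.
  apply: EW; rewrite mxE [X in _ + X]mxE; apply: wspanB.
    rewrite mxE; apply: wspan_sum => k _; rewrite !mxE mulr_algl.
    exact: wspanZ.
  rewrite mxE; apply: wspan_sum => k _; rewrite !mxE mulr_algr.
  exact: wspanZ.
apply: eq_bigr => q _; rewrite /mx_ext_form.
rewrite !cmx_smxC mulrA cmx_smxC -!mulrA -mulrBr -!cmxM.
rewrite -(raddfB (map_mx (in_alg B))).
by rewrite smx_cmxE linearZ.
Qed.

End Functional.
End MatrixExtension.

(** * Evaluation at points and permanents *)

Section Evaluation.
Context {K : fieldType} {L : lieAlgType K} {G : nmodType}.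
(* chi a r is the value a^r of x^r at a, for G = nat or G = int. *)
Context (chi : K -> G -> K).
Local Notation T := (tensor_powers L G).

Definition tens_ev (a : K) : T -> L :=
  tens_lift (fun r => chi a r \*: (idfun : {linear L -> L})).
HB.instance Definition _ a := GRing.Linear.on (tens_ev a).

Lemma tens_evX a e r : tens_ev a (tensX e r) = chi a r *: e.
Proof. exact: tens_liftX. Qed.

Lemma tens_ev_lie a : (forall r s, chi a (r + s) = chi a r * chi a s) ->
  {morph tens_ev a : x y / lie x y}.
Proof.
move=> chiD x y; elim/(@tensX_ind K L G): x => [|x x' IH IH'|e r].
- by rewrite lie0x !raddf0 lie0x.
- by rewrite lieDl !linearD /= IH IH' lieDl.
elim/(@tensX_ind K L G): y => [|y y' IH IH'|f s].
- by rewrite liex0 !raddf0 liex0.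
- by rewrite lieDr !linearD /= IH IH' lieDr.
by rewrite lie_tensX !tens_evX lieZl lieZr scalerA chiD.
Qed.

Context {n : nat}.
Context (rho : {linear L -> 'M[K]_n.+1}).

(* The slot (a, (e, (i, j))) stands for the linear form
   x |-> rho([e, x(a)])_ij on L (x) K[G]. *)
Definition slot := (K * (L * ('I_n.+1 * 'I_n.+1)))%type.
Implicit Types (c : slot) (s : seq slot) (x y : T) (xs : seq T).

Definition slot_form c x : K :=
  rho (lie c.2.1 (tens_ev c.1 x)) c.2.2.1 c.2.2.2.

Fact slot_form_linear c : linear_for *%R (slot_form c).
Proof.
by move=> a x y; rewrite /slot_form linearP lieDr lieZr linearP !mxE.
Qed.
HB.instance Definition _ c :=
  GRing.isLinear.Build K T K _ (slot_form c) (slot_form_linear c).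

(* The permanent of the matrix of the slot_form c x, for c in s, x in xs. *)
Fixpoint slot_perm s xs : K :=
  if s is c :: s' then
    \sum_(q <- picks xs) slot_form c q.1 * slot_perm s' q.2
  else 1.

Lemma slot_perm_small s xs : (size xs < size s)%N -> slot_perm s xs = 0.
Proof.
elim: s xs => //= c s IH xs sxs; rewrite big_seq big1 // => q /size_pick sq.
by rewrite IH ?mulr0 // -ltnS -sq.
Qed.

Context (rhoL : lie_morph rho)
  (chiD : forall a (r s : G), a != 0 ->
    chi a (r + s) = chi a r * chi a s).

(** Each slot adds one matrix factor. If [y] takes the value [c.2.1] at the head point and vanishes
    at the others, the third conclusion for the tail kills its action on the older factors; only
    [rho c.2.1] in the newest factor is left, which yields the fourth conclusion. *)
Lemma slot_realization s : all (fun c => c.1 != 0) s ->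
  exists (B : algType K) (psi : {linear T -> B}) (E : {linear B -> K^o}),
  [/\ lie_morph psi,
      forall xs, (size xs <= size s)%N ->
        E (\prod_(x <- xs) psi x) = slot_perm s xs,
      forall y, (forall c, c \in s -> tens_ev c.1 y = 0) -> psi y = 0 &
      forall c s' y b, s = c :: s' -> tens_ev c.1 y = c.2.1 ->
        (forall c', c' \in s' -> tens_ev c'.1 y = 0) ->
        psi y * b = b * psi y -> E b = 0].
Proof.
elim: s => [_|c s IH /= /andP[c0 /IH[B [psi [E [psiL Eperm psi0 _]]]]]].
  exists K^o, \0, idfun; split=> //= [x y|[|//] _].
    by rewrite mulr0 subrr.
  by rewrite big_nil.
pose rhoa : {linear T -> 'M[K]_n.+1} := rho \o tens_ev c.1.
have rhoaL : lie_morph rhoa.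
  by move=> x y; rewrite /rhoa /= tens_ev_lie ?rhoL // => r t; apply: chiD.
exists (mx_alg B n), (mx_ext psi rhoa).
suff : exists E' : {linear mx_alg B n -> K^o},
   (forall xs, (size xs <= (size s).+1)%N ->
        E' (\prod_(x <- xs) mx_ext psi rhoa x) = slot_perm (c :: s) xs)
   /\ forall y b, tens_ev c.1 y = c.2.1 -> psi y = 0 ->
        mx_ext psi rhoa y * b = b * mx_ext psi rhoa y -> E' b = 0.
  case=> E' [E'perm E'comm]; exists E'; split=> //.
  - exact: mx_ext_lie.
  - move=> y y0; rewrite /= /mx_ext psi0; last first.
      by move=> c' c's; rewrite y0 // inE c's orbT.
   rewrite /rhoa /= y0 ?mem_head // /const_mx_alg /scalar_mx_alg.
    by rewrite !raddf0 addr0.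
  - by move=> _ _ y b [<- <-] yc ys; apply: (E'comm) => //; apply: psi0.
(* As [rho] preserves brackets, the commutator with [rho c.2.1] produces [slot_form c]. *)
exists (mx_ext_form E (rho c.2.1) c.2.2.1 c.2.2.2); split=> [xs sxs|y b yc y0].
  rewrite [LHS]mx_ext_form_prod => [|ys sys]; last first.
    have sys' := leq_trans sys sxs.
    by rewrite Eperm ?slot_perm_small // ltnW.
  rewrite /= big_seq [RHS]big_seq; apply: eq_bigr => q /size_pick sq.
  by rewrite Eperm -?rhoL // -ltnS -sq.
rewrite /= /mx_ext /rhoa y0 /= yc /scalar_mx_alg raddf0 addr0.
exact: mx_ext_form_comm.
Qed.
End Evaluation.

(** Multiplied by the product of the ['X - a%:P] for [a] in [A], the polynomial vanishes everywhere;
    in characteristic 0 the natural numbers supply too many roots. *)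
Lemma poly_eq0_outside (K : fieldType) (p : {poly K}) (A : seq K) :
  [pchar K] =i pred0 -> (forall a, a \notin A -> p.[a] = 0) -> p = 0.
Proof.
move=> charK0 p0; pose q := \prod_(a <- A) ('X - a%:P).
have q0 : q != 0 by rewrite monic_neq0 // monic_prod_XsubC.
apply/eqP; case: (eqVneq (p * q) 0) => [/eqP|pq0].
  by rewrite mulf_eq0 (negPf q0) orbF.
pose rs : seq K := [seq i%:R | i <- iota 0 (size (p * q))].
suff : (size rs < size (p * q)%R)%N by rewrite size_map size_iota ltnn.
apply: max_poly_roots => //.
  apply/allP => a _; rewrite rootE hornerM mulf_eq0.
  have [aA|aA] := boolP (a \in A); last by rewrite p0 // eqxx.
  by rewrite -[X in _ || X]rootE root_prod_XsubC aA orbT.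
rewrite map_inj_uniq ?iota_uniq // => i j /eqP; apply: contraTeq.
have charP := (pcharf0P K).1 charK0.
wlog ij : i j / (i < j)%N => [th|_].
  by rewrite neq_ltn => /orP[] ij; [|rewrite eq_sym]; apply: th;
    rewrite // ltn_eqF.
rewrite -subr_eq0 -oppr_eq0 opprB -natrB ?(ltnW ij) //.
by rewrite charP subn_eq0 -ltnNge.
Qed.

(** * Symmetrized products and leading terms *)

Section SymmetricProduct.
Context {K : fieldType} {L : lieAlgType K} {B : algType K}.
Context (emb : {linear L -> B}).
Context (embL : lie_morph emb).
Local Notation span_lt m := (wspan emb (fun k => (k < m)%N)).

(* The sum over all permutations of xs of their products, if m = size xs. *)
Fixpoint sym_prod m (xs : seq L) : B :=
  if m is m'.+1 then \sum_(q <- picks xs) emb q.1 * sym_prod m' q.2 else 1.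

(** Swapping two neighbouring letters costs their bracket, hence a word shorter by one. *)
Lemma pick_front xs q : q \in picks xs ->
  span_lt (size xs) (emb q.1 * \prod_(x <- q.2) emb x - \prod_(x <- xs) emb x).
Proof.
elim: xs q => //= x xs IH q; rewrite inE => /predU1P[->|/mapP[q' q'P ->]] /=.
  by rewrite big_cons subrr; exact: wspan0.
rewrite !big_cons mulrA -[emb q'.1 * emb x](subrK (emb x * emb q'.1)).
rewrite -embL mulrDl -addrA -mulrA -mulrBr; apply: wspanD.
  have := @wspan_word _ _ _ emb (pred1 (size xs)) (lie q'.1 x :: q'.2).
  rewrite big_cons /= (size_pick q'P) => /(_ (eqxx _)) w.
  by apply: wspan_sub w _ => k /eqP ->.
by apply: wspanMl (IH _ q'P) _.
Qed.

Lemma sym_prod_fact xs :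
  span_lt (size xs)
    (sym_prod (size xs) xs - (size xs)`!%:R *: \prod_(x <- xs) emb x).
Proof.
move sz: (size xs) => m; elim: m xs sz => [|m IH] xs sz.
  by rewrite (size0nil sz) big_nil scale1r subrr; exact: wspan0.
have -> : m.+1`!%:R *: \prod_(x <- xs) emb x =
    \sum_(q <- picks xs) m`!%:R *: \prod_(x <- xs) emb x.
  rewrite big_const_seq count_predT size_picks sz iter_addr_0 scalerMnl.
  by rewrite factS mulnC mulrnA.
rewrite /= -sumrB; apply: wspan_sum => q qP.
have sq : size q.2 = m by have := size_pick qP; rewrite sz => -[].
rewrite -(subrK (m`!%:R *: (emb q.1 * \prod_(x <- q.2) emb x))
  (emb q.1 * _)) -addrA; apply: wspanD.
  by rewrite scalerAr -mulrBr; apply: wspanMl (IH _ sq) _.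
by rewrite -scalerBr; apply: wspanZ; rewrite -sz; apply: pick_front.
Qed.

Lemma wspan_top m b : wspan emb (fun k => (k < m.+1)%N) b ->
  exists2 fam : seq (K * seq L), all (fun p => size p.2 == m) fam &
    span_lt m (b - \sum_(p <- fam) p.1 *: \prod_(x <- p.2) emb x).
Proof.
elim=> [|c c' _ [f fP IH] _ [f' f'P IH']|a w]; last 1 first.
- rewrite ltnS leq_eqVlt => /predU1P[sw|sw].
    exists [:: (a, w)]; first by rewrite /= sw eqxx.
    by rewrite big_seq1 subrr; exact: wspan0.
  by exists [::]; rewrite // big_nil subr0; apply: wspanW.
- by exists [::]; rewrite // big_nil subr0; exact: wspan0.
exists (f ++ f'); first by rewrite all_cat fP.
by rewrite big_cat opprD addrACA; apply: wspanD.
Qed.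

End SymmetricProduct.

Lemma env_wspan (K : fieldType) (L : lieAlgType K) (u : enveloping L) :
  exists m, wspan (@env_inj K L) (fun k => (k < m)%N) u.
Proof.
elim/(@env_ind K L): u => [a|u v [m um] [m' vm']|u v [m um] [m' vm']|x].
- exists 1%N.
  have := @wspanW _ _ _ (@env_inj K L) (fun k => k < 1)%N a [::] isT.
  by rewrite big_nil.
- exists (maxn m m').
  by apply: wspanD; [apply: wspan_sub um _|apply: wspan_sub vm' _] => k km;
    rewrite leq_max km ?orbT.
- exists (m + m')%N; apply: wspanM um vm' _ => k l km lm.
  by rewrite -addnS leq_add // ltnW.
- exists 2%N.
  have := @wspan_word _ _ _ (@env_inj K L) (fun k => k < 2)%N [:: x].
  by rewrite big_seq1; apply.
Qed.

Section Coordinates.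
Context {K : fieldType} {L : finLieAlgType K} {G : nmodType}.
Local Notation T := (tensor_powers L G).
Local Notation b := (vbasis (fullv : {vspace L})).

Definition tens_coord (c : G * 'I_(\dim (fullv : {vspace L}))) (x : T) : K :=
  coord b c.2 x@_(c.1).

Fact tens_coord_linear c : linear_for *%R (tens_coord c).
Proof.
by move=> a x y; rewrite /tens_coord mcoeffD [(a *: x)@__]tensor_coeffZ linearP.
Qed.
HB.instance Definition _ c :=
  GRing.isLinear.Build K T K _ (tens_coord c) (tens_coord_linear c).

Lemma tens_coordE (d : {fset G}) (x : T) : msupp x `<=` d ->
  x = \sum_(r <- d) \sum_i tens_coord (r, i) x *: tensX b`_i r.
Proof.
move=> xd; rewrite {1}[x]tensXP.
rewrite (@tensor_sumW _ _ _ _ (fun e r => tensX e r) _ _ _ xd) //; last first.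
  by move=> r; rewrite tensX0.
apply: eq_bigr => r _; rewrite {1}(coord_vbasis (memvf x@_r)).
rewrite (big_morph _ (@tensX_is_additive K L G r) (tensX0 r)).
by apply: eq_bigr => i _; rewrite tensXZ.
Qed.

Lemma mul_sum_coord (B : algType K) (f : {linear T -> B}) (fam : seq (T * B)) :
  (forall c, \sum_(p <- fam) tens_coord c p.1 *: p.2 = 0) ->
  \sum_(p <- fam) f p.1 * p.2 = 0.
Proof.
move=> fam0; pose d := \bigcup_(p <- fam) msupp p.1.
pose F p := \sum_(r <- d)
  \sum_i tens_coord (r, i) p.1 *: (f (tensX b`_i r) * p.2).
rewrite (eq_big_seq F) => [|p pfam]; last first.
  rewrite {1}(@tens_coordE d p.1); last first.
    by rewrite (bigfcup_sup (fun p => msupp p.1)).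
  rewrite linear_sum mulr_suml; apply: eq_bigr => r _.
  rewrite linear_sum mulr_suml; apply: eq_bigr => i _.
  by rewrite linearZ /= scalerAl.
rewrite exchange_big big1_seq //= => r _.
rewrite exchange_big big1_seq //= => i _.
under eq_bigr do rewrite scalerAr.
by rewrite -mulr_sumr fam0 mulr0.
Qed.

End Coordinates.

Section Centre.
Context {K : fieldType} {L : finLieAlgType K} {G : nmodType}.
Local Notation T := (tensor_powers L G).
Local Notation U := (enveloping T).
Local Notation inj := (@env_inj K T).
Context (charK0 : [pchar K] =i pred0).
Context (centerless : forall x : L, (forall y, lie y x = 0) -> x = 0).

Context (chi : K -> G -> K) (X : G).
Local Notation ev := (tens_ev chi).
Context (chiD : forall a (r s : G), a != 0 ->
  chi a (r + s) = chi a r * chi a s).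
Context (chiX : forall a k, a != 0 -> chi a (X *+ k) = a ^+ k).
Context (chi_poly : forall d : {fset G}, exists (N : nat) (h : G -> nat),
  {in d &, injective h} /\
  forall a r, a != 0 -> r \in d -> a ^+ N * chi a r = a ^+ h r).

Lemma tens_ev_interpolation (A : seq K) a e :
  a != 0 -> all (fun c => c != 0) A -> a \notin A ->
  exists2 x : T, ev a x = e & forall c, c \in A -> ev c x = 0.
Proof.
move=> a0 A0 aA; pose q := \prod_(c <- A) ('X - c%:P).
have qa : q.[a] != 0 by rewrite -rootE root_prod_XsubC.
pose x : T := \sum_(k < size q) tensX ((q`_k / q.[a]) *: e) (X *+ k).
have evx c : c != 0 -> ev c x = (q.[c] / q.[a]) *: e.
  move=> c0; rewrite linear_sum (horner_coef q c) mulr_suml scaler_suml.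
  apply: eq_bigr => k _; rewrite [LHS]tens_evX chiX // scalerA.
  by rewrite mulrC mulrAC.
exists x => [|c cA]; first by rewrite evx // divff // scale1r.
rewrite evx ?(allP A0) //.
have /rootP -> : root q c by rewrite root_prod_XsubC.
by rewrite mul0r scale0r.
Qed.

Lemma tens_ev_eq0 (A : seq K) (x : T) :
  (forall a, a != 0 -> a \notin A -> ev a x = 0) -> x = 0.
Proof.
move=> x0; apply: tensor_coeffP => r; rewrite mcoeff0.
have [rx|/mcoeff_outdom //] := boolP (r \in msupp x).
have [N [h [hI hP]]] := chi_poly (msupp x).
rewrite (coord_vbasis (memvf x@_r)) big1 // => i _.
pose p := \sum_(s <- msupp x) tens_coord (s, i) x *: 'X^(h s).
suff p0 : p = 0.
  have : p`_(h r) = 0 by rewrite p0 coef0.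
  rewrite coef_sum (big_rem r) //= [X in _ + X]big1_seq.
    by rewrite coefZ coefXn eqxx mulr1 addr0 /tens_coord /= => ->;
      rewrite scale0r.
  move=> s /=; rewrite mem_rem_uniq ?fset_uniq // inE => /andP[sr sx].
  rewrite coefZ coefXn; case: eqP => [/hI|]; last by rewrite mulr0.
  by move=> /(_ rx sx) rs; rewrite rs eqxx in sr.
apply: (@poly_eq0_outside _ _ (0 :: A)) => // a.
rewrite inE negb_or => /andP[a0 aA].
have -> : p.[a] = a ^+ N * coord (vbasis fullv) i (ev a x).
  rewrite horner_sum /tens_ev /tens_lift linear_sum mulr_sumr.
  apply: eq_big_seq => s sx; rewrite hornerZ hornerXn -hP //=.
  by rewrite linearZ mulrCA; congr (_ * _); exact: mulrC.
by rewrite x0 // raddf0 mulr0.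
Qed.

Context {n : nat}.
Context (rho : {linear L -> 'M[K]_n.+1}).
Context (rhoL : lie_morph rho) (rho_inj : injective rho).
Local Notation slot := (@slot K L n).
Local Notation slot_form := (slot_form chi rho).
Local Notation slot_perm := (slot_perm chi rho).

Definition generic (s : seq slot) : bool :=
  all (fun c => c.1 != 0) s && uniq [seq c.1 | c <- s].

Lemma central_slot_form c s : generic (c :: s) ->
  exists F : {linear U -> K^o},
    (forall xs, (size xs <= (size s).+1)%N ->
       F (\prod_(x <- xs) inj x) = slot_perm (c :: s) xs)
    /\ forall z, (forall u, z * u = u * z) -> F z = 0.
Proof.
case/and3P=> /= cs0 /= cs us.
have /andP[c0 s0] := cs0.
have [B [psi [E [psiL Eperm _ Ecomm]]]] :=
  @slot_realization _ _ _ chi _ rho rhoL chiD (c :: s) cs0.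
have [Phi [PhiE _]] := env_universal psiL.
exists (E \o Phi); split=> [xs sxs|z zC] /=.
  rewrite -[RHS](Eperm xs sxs) rmorph_prod; congr (E _).
  by apply: eq_bigr => x _; exact: PhiE.
have [|y yc ys] := tens_ev_interpolation c.2.1 c0 _ cs.
  by rewrite all_map.
apply: (Ecomm c s y) => // [c' c's|]; first by apply: ys; apply: map_f.
by rewrite -PhiE -!rmorphM zC.
Qed.

Lemma slot_form_eq0 (A : seq K) (x : T) :
  (forall c : slot, c.1 != 0 -> c.1 \notin A -> slot_form c x = 0) -> x = 0.
Proof.
move=> x0; apply: (@tens_ev_eq0 A) => a a0 aA; apply: centerless => e.
apply: rho_inj; rewrite raddf0; apply/matrixP => i j.
by rewrite mxE -(x0 (a, (e, (i, j)))).
Qed.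

Lemma sym_prod_eq0 m (fam : seq (K * seq T)) :
  (forall s, generic s -> size s = m ->
     \sum_(p <- fam) p.1 * slot_perm s p.2 = 0) ->
  \sum_(p <- fam) p.1 *: sym_prod inj m p.2 = 0.
Proof.
elim: m fam => [|m IH] fam fam0.
  have := fam0 [::] isT erefl; rewrite /= => fam1.
  by rewrite -scaler_suml -(eq_bigr _ (fun p _ => mulr1 p.1)) fam1 scale0r.
pose fam' := [seq (q.1, p.1 *: sym_prod inj m q.2) | p <- fam, q <- picks p.2].
transitivity (\sum_(p <- fam') inj p.1 * p.2).
  rewrite big_allpairs_dep; apply: eq_bigr => p _.
  by rewrite /= scaler_sumr; apply: eq_bigr => q _; rewrite scalerAr.
apply: mul_sum_coord => c.
have := IH [seq (p.1 * tens_coord c q.1, q.2) | p <- fam, q <- picks p.2].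
rewrite !big_allpairs_dep => IH'.
under eq_bigr do under eq_bigr do rewrite /= scalerA mulrC.
apply: IH' => s sg sm; rewrite big_allpairs_dep /=.
pose Y := \sum_(p <- fam) \sum_(q <- picks p.2) (p.1 * slot_perm s q.2) *: q.1.
transitivity (tens_coord c Y).
  rewrite linear_sum; apply: eq_bigr => p _; rewrite linear_sum.
  by apply: eq_bigr => q _; rewrite linearZ /= mulrAC.
rewrite (@slot_form_eq0 [seq c.1 | c <- s] Y) ?raddf0 // => c' c'0 c's.
rewrite -(fam0 (c' :: s)) /= ?sm //; last first.
  by case/andP: sg => s0 us; rewrite /generic /= c'0 s0 c's.
rewrite linear_sum; apply: eq_bigr => p _; rewrite linear_sum mulr_sumr.
by apply: eq_bigr => q _; rewrite linearZ /= mulrAC mulrA.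
Qed.

Lemma central_lower m z : (forall u : U, z * u = u * z) ->
  wspan inj (fun k => (k < m.+2)%N) z -> wspan inj (fun k => (k < m.+1)%N) z.
Proof.
move=> zC /wspan_top[fam /allP famP]; set w := \sum_(p <- fam) _ => zw.
pose f := m.+1`!%:R : K.
have f0 : f != 0 by rewrite ((pcharf0P K).1 charK0) -lt0n fact_gt0.
suff wl : wspan inj (fun k => (k < m.+1)%N) (f *: w).
  rewrite -(subrK w z); apply: wspanD => //.
  by rewrite -[w](scalerK f0); apply: wspanZ.
have sym0 : \sum_(p <- fam) p.1 *: sym_prod inj m.+1 p.2 = 0.
  apply: sym_prod_eq0 => -[//|c s] sg [sm].
  have [F [Fperm FC]] := central_slot_form sg.
  have : F (z - w) = 0.
    elim: zw => [|b b' _ Fb _ Fb'|a xs sxs]; first exact: raddf0.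
      by rewrite raddfD /= Fb Fb' addr0.
    by rewrite linearZ /= Fperm ?slot_perm_small /= ?sm ?scaler0 // ltnW.
  rewrite raddfB /= FC // sub0r => /eqP; rewrite oppr_eq0 => /eqP Fw.
  transitivity (F w) => //; rewrite linear_sum.
  apply: eq_big_seq => p /famP/eqP sp; rewrite [RHS]linearZ; congr (_ * _).
  by rewrite [RHS]Fperm // sp sm.
rewrite -[f *: w]opprK -[- (f *: w)]add0r -{1}sym0 scaler_sumr -sumrB.
rewrite -scaleN1r; apply: wspanZ; apply: wspan_sum => p /famP/eqP sp.
rewrite scalerA (mulrC f) -scalerA -scalerBr; apply: wspanZ.
by have := @sym_prod_fact _ _ _ _ (@env_inj_lie K T) p.2; rewrite sp.
Qed.

Lemma center_enveloping_tensor : center U = scalars U.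
Proof.
apply/seteqP; split=> [z zC|_ [a _ <-] u]; last by rewrite mulr_algl mulr_algr.
have [m zm] := env_wspan z.
have {m zm} : wspan inj (fun k => (k < 1)%N) z.
  elim: m zm => [|[|m] IH] // zm; first by apply: wspan_sub zm _.
  by apply: IH; apply: central_lower.
elim=> [|u v _ [a _ <-] _ [b _ <-]|a [|//] _].
- by exists 0; rewrite ?scale0r.
- by exists (a + b); rewrite ?scalerDl.
- by exists a; rewrite ?big_nil.
Qed.

End Centre.

Section FaithfulRepresentation.
Context {K : fieldType} {L : finLieAlgType K}.

(* Right multiplication by the matrix of a row vector reverses composition,
   so the adjoint action is taken on the right. *)
Definition adjr_mx n (b : n.-tuple L) (e : L) : 'M[K]_n :=
  \matrix_(i, j) coord b j (lie b`_i e).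

Fact adjr_mx_linear n (b : n.-tuple L) : linear (adjr_mx b).
Proof.
by move=> a e f; apply/matrixP => i j; rewrite !mxE lieDr lieZr linearP.
Qed.
HB.instance Definition _ n (b : n.-tuple L) :=
  GRing.isLinear.Build K L 'M[K]_n _ (adjr_mx b) (adjr_mx_linear b).

Lemma adjr_mxM n (b : n.-tuple L) e f : basis_of fullv b ->
  adjr_mx b e *m adjr_mx b f = \matrix_(i, j) coord b j (lie (lie b`_i e) f).
Proof.
move=> bb; apply/matrixP => i j; rewrite !mxE.
rewrite [in RHS](coord_basis bb (memvf (lie b`_i e))) lie_suml linear_sum.
by apply: eq_bigr => k _; rewrite !mxE lieZl linearZ.
Qed.

Lemma adjr_mx_lie n (b : n.-tuple L) e f : basis_of fullv b ->
  adjr_mx b (lie e f) = adjr_mx b e *m adjr_mx b f - adjr_mx b f *m adjr_mx b e.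
Proof.
move=> bb; rewrite !adjr_mxM //; apply/matrixP => i j; rewrite !mxE -linearB /=.
have lieNl x y : lie (- x) y = - lie x y :> L.
  by rewrite -scaleN1r lieZl scaleN1r.
congr (coord b j _); have := lie_jacobi b`_i e f.
rewrite (lieC e (lie f _)) (lieC f b`_i) lieNl opprK (lieC f).
by move/eqP; rewrite subr_eq0 => /eqP <-; rewrite addrK.
Qed.

Context (centerless : forall x : L, (forall y, lie y x = 0) -> x = 0).

Lemma adjr_mx_inj n (b : n.-tuple L) :
  basis_of fullv b -> injective (adjr_mx b).
Proof.
move=> bb; apply: raddf_inj => e e0; apply: centerless => y.
rewrite (coord_basis bb (memvf y)) lie_suml big1 // => i _.
rewrite lieZl (coord_basis bb (memvf (lie b`_i e))) big1 ?scaler0 // => j _.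
by have /matrixP/(_ i j) := e0; rewrite !mxE => ->; rewrite scale0r.
Qed.

Lemma faithful_representation :
  exists n (rho : {linear L -> 'M[K]_n.+1}), lie_morph rho /\ injective rho.
Proof.
have : basis_of fullv (vbasis (fullv : {vspace L})) by apply: vbasisP.
move: (vbasis _); case dimE: (\dim _) => [|n] b bb.
  have L0 (x : L) : x = 0.
    have L0 : fullv = 0%VS :> {vspace L} by apply/eqP; rewrite -dimv_eq0 dimE.
    by apply/eqP; rewrite -memv0 -L0 memvf.
  exists 0%N, \0; split=> [x y|x y _] /=; first by rewrite mulr0 subrr.
  by rewrite (L0 x) (L0 y).
exists n, (adjr_mx b); split; last exact: adjr_mx_inj.
by move=> x y; exact: adjr_mx_lie.
Qed.

End FaithfulRepresentation.

Lemma semisimple_centerless (K : fieldType) (L : finLieAlgType K) (x : L) :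
  semisimple L -> (forall y, lie y x = 0) -> x = 0.
Proof.
move=> ssL xC; have : <[x]>%VS = 0%VS :> {vspace L}.
  apply: ssL => [y z /vlineP[a ->]|]; first by rewrite lieZr xC scaler0 mem0v.
  exists 1%N => /=; apply/eqP; rewrite -subv0; apply/lievP => u v.
  by move=> /vlineP[a ->] /vlineP[c ->]; rewrite lieZl lieZr xC !scaler0 mem0v.
by move=> x0; apply/eqP; rewrite -memv0 -x0 memv_line.
Qed.

Theorem proposition3p3 (K : closedFieldType) (charK0 : [pchar K] =i pred0)
    (L : finLieAlgType K) (ssL : semisimple L) :
  center (enveloping (current_algebra L))
    = scalars (enveloping (current_algebra L))
  /\ center (enveloping (loop_algebra L))
    = scalars (enveloping (loop_algebra L)).
Proof.
have centerless x := semisimple_centerless (x := x) ssL.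
have [n [rho [rhoL rho_inj]]] := faithful_representation centerless.
split.
  apply: (@center_enveloping_tensor _ _ nat charK0 centerless
    (fun a r => a ^+ r) 1%N _ _ _ n rho rhoL rho_inj).
  - by move=> a r s _; exact: exprD.
  - by move=> a k _; congr (a ^+ _); rewrite -[RHS](natn k).
  - by move=> d; exists 0%N, id; split=> [r s _ _ //|a r _ _]; rewrite mul1r.
apply: (@center_enveloping_tensor _ _ int charK0 centerless
  (fun a r => a ^ r) 1 _ _ _ n rho rhoL rho_inj).
- by move=> a r s a0; rewrite expfzDr.
- by move=> a k _; rewrite /= natz.
move=> d; pose N := (\sum_(r <- d) `|r|)%N.
have absN r : r \in d -> r + N%:Z = `|(r + N%:Z)%R|%N.
  move=> rd.
  have : (`|r| <= N)%N by rewrite /N (big_rem r) //= leq_addr.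
  rewrite -lez_nat abszE => /Num.Theory.lerNnormlW rN.
  by rewrite gez0_abs // addrC -Num.Theory.lerBlDl sub0r.
exists N, (fun r => `|(r + N%:Z)%R|%N).
split=> [r s rd sd /(congr1 Posz)|a r a0 rd].
  by rewrite -!absN // => /addIr.
by rewrite !exprnP -absN // addrC expfzDr.
Qed.
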